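(* Let $X$ be a set with $|X|\geq 2$, and let $\Upsilon=\{X,X'\}\in\mathcal{CS}_X$ be the partition of $X\cup X'$ with exactly the two blocks $X$ and $X'$. Then $\mathcal{IP}_X\cup\{\Upsilon\}$ is a maximal inverse subsemigroup of $\mathcal{CS}_X$.
   Context: Let $X$ be an arbitrary set and let $X'=\{x':x\in X\}$ be a disjoint copy of $X$, with $x\mapsto x'$ a fixed bijection $X\to X'$; the inverse bijection is also denoted by $'$. Let $\mathcal{CS}_X$ be the set of all partitions of $X\cup X'$ into nonempty blocks. For $a\in\mathcal{CS}_X$ write $x\equiv_a y$ if $x,y\in X\cup X'$ lie in the same block of $a$. The product $ab$ of $a,b\in\mathcal{CS}_X$ is the partition corresponding to the equivalence relation $\equiv$ on $X\cup X'$ defined, for $x,y\in X$, by: (i) $x\equiv y$ iff $x\equiv_a y$ or there are $s\ge 1$ and $c_1,\dots,c_{2s}\in X$ with $x\equiv_a c_1'$, $c_1\equiv_b c_2$, $c_2'\equiv_a c_3'$, $\dots$, $c_{2s-1}\equiv_b c_{2s}$, $c_{2s}'\equiv_a y$; (ii) $x'\equiv y'$ iff $x'\equiv_b y'$ or there are $s\ge 1$ and $c_1,\dots,c_{2s}\in X$ with $x'\equiv_b c_1$, $c_1'\equiv_a c_2'$, $c_2\equiv_b c_3$, $\dots$, $c_{2s-1}'\equiv_a c_{2s}'$, $c_{2s}\equiv_b y'$; (iii) $x\equiv y'$ iff $y'\equiv x$ iff there are $s\ge 1$ and $c_1,\dots,c_{2s-1}\in X$ with $x\equiv_a c_1'$,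 $c_1\equiv_b c_2$, $c_2'\equiv_a c_3'$, $\dots$, $c_{2s-2}'\equiv_a c_{2s-1}'$, $c_{2s-1}\equiv_b y'$. With this product $\mathcal{CS}_X$ is a semigroup, and $\mathcal{IP}_X$ is the subsemigroup of all $a\in\mathcal{CS}_X$ each of whose blocks meets both $X$ and $X'$. An inverse subsemigroup of $\mathcal{CS}_X$ is a subsemigroup that is itself an inverse semigroup; a maximal inverse subsemigroup is one that is maximal, with respect to inclusion, among the inverse subsemigroups of $\mathcal{CS}_X$. *)

(* Defs.v *)
From HB Require Import structures.
From mathcomp Require Import all_boot.
From mathcomp Require Import boolp classical_sets.
From mathcomp Require Import zify.

Set Implicit Arguments.
Unset Strict Implicit.
Unset Printing Implicit Defensive.

Local Open Scope classical_set_scope.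

Section InverseSubsemigroups.
Local Open Scope group_scope.
Variable S : semigroupType.
Implicit Types (A B : set S) (x y : S).

Definition subsemigroup A : Prop :=
  A !=set0 /\ forall x y, A x -> A y -> A (x * y).

Definition inverse_of x y : Prop := x * y * x = x /\ y * x * y = y.

Definition inverse_subsemigroup A : Prop :=
  subsemigroup A /\ forall x, A x -> exists! y, A y /\ inverse_of x y.

Definition maximal_inverse_subsemigroup A : Prop :=
  inverse_subsemigroup A /\
  forall B, inverse_subsemigroup B -> A `<=` B -> B = A.

End InverseSubsemigroups.

(* The union of X and its disjoint copy X' is X + X: the element x is [inl x]
   and its copy x' is [inr x]. *)
Record CS (X : Type) := MkCS {
  blocks : set (set (X + X));
  blocksP : partition blocks id [set: X + X]
}.

HB.instance Definition _ (X : Type) := gen_eqMixin (CS X).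
HB.instance Definition _ (X : Type) := gen_choiceMixin (CS X).

Definition same_block (X : Type) (a : CS X) (u v : X + X) : Prop :=
  exists2 U, blocks a U & U u /\ U v.

(* The three clauses of the product, for arbitrary relations A and B in place
   of "same block of a" and "same block of b". A sequence c_1, c_2, ... is the
   restriction of a function c : nat -> X, whose other values are irrelevant. *)
Section Glue.
Variables (X : Type) (A B : X + X -> X + X -> Prop).

Definition glue_top (x y : X) : Prop :=
  A (inl x) (inl y) \/
  exists (s : nat) (c : nat -> X),
    [/\ 1 <= s,
        A (inl x) (inr (c 1)),
        forall i, 1 <= i <= s -> B (inl (c i.*2.-1)) (inl (c i.*2)),
        forall i, 1 <= i < s -> A (inr (c i.*2)) (inr (c i.*2.+1)) &
        A (inr (c s.*2)) (inl y)].

Definition glue_bot (x y : X) : Prop :=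
  B (inr x) (inr y) \/
  exists (s : nat) (c : nat -> X),
    [/\ 1 <= s,
        B (inr x) (inl (c 1)),
        forall i, 1 <= i <= s -> A (inr (c i.*2.-1)) (inr (c i.*2)),
        forall i, 1 <= i < s -> B (inl (c i.*2)) (inl (c i.*2.+1)) &
        B (inl (c s.*2)) (inr y)].

Definition glue_cross (x y : X) : Prop :=
  exists (s : nat) (c : nat -> X),
    [/\ 1 <= s,
        A (inl x) (inr (c 1)),
        forall i, 1 <= i < s -> B (inl (c i.*2.-1)) (inl (c i.*2)),
        forall i, 1 <= i < s -> A (inr (c i.*2)) (inr (c i.*2.+1)) &
        B (inl (c s.*2.-1)) (inr y)].

Definition glue (u v : X + X) : Prop :=
  match u, v with
  | inl x, inl y => glue_top x y
  | inr x, inr y => glue_bot x y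
  | inl x, inr y => glue_cross x y
  | inr y, inl x => glue_cross x y
  end.

End Glue.

Record is_equiv (T : Type) (R : T -> T -> Prop) : Prop := IsEquiv {
  equiv_refl : forall u, R u u;
  equiv_sym : forall u v, R u v -> R v u;
  equiv_trans : forall u v w, R u v -> R v w -> R u w
}.

Definition classes_of (T : Type) (R : T -> T -> Prop) : set (set T) :=
  [set R u | u in [set: T]].

Lemma classes_ofP (T : Type) (R : T -> T -> Prop) :
  is_equiv R -> partition (classes_of R) id [set: T].
Proof.
case=> Rr Rs Rt; split.
- rewrite eqEsubset; split=> // u _; exists (R u); last exact: Rr.
  by exists u.
- move=> _ _ [u _ <-] [v _ <-] [w [uw vw]].
  rewrite funeqE => z; rewrite propeqE; split=> h.
    exact: Rt vw (Rt _ _ _ (Rs _ _ uw) h).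
  exact: Rt uw (Rt _ _ _ (Rs _ _ vw) h).
- by move=> _ [u _ <-]; exists u; apply: Rr.
Qed.

Lemma block_of (X : Type) (a : CS X) u : exists2 U, blocks a U & U u.
Proof.
have [cP _ _] := blocksP a; have : [set: X + X] u by [].
by rewrite -cP => -[U PU Uu]; exists U.
Qed.

Lemma block_inj (X : Type) (a : CS X) U V u :
  blocks a U -> blocks a V -> U u -> V u -> U = V.
Proof. by have [_ tP _] := blocksP a; move=> *; apply: tP => //; exists u. Qed.

Lemma same_block_equiv (X : Type) (a : CS X) : is_equiv (same_block a).
Proof.
split=> [u|u v [U aU [Uu Uv]]|u v w [U aU [Uu Uv]] [V aV [Vv Vw]]].
- by have [U aU Uu] := block_of a u; exists U.
- by exists U.
- by exists U => //; split=> //; rewrite (block_inj aU aV Uv Vv).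
Qed.

Definition CS_of (X : Type) (R : X + X -> X + X -> Prop) (eR : is_equiv R) :
  CS X := MkCS (classes_ofP eR).

Lemma same_block_CS_of (X : Type) (R : X + X -> X + X -> Prop)
  (eR : is_equiv R) : same_block (CS_of eR) = R.
Proof.
case: (eR) => Rr Rs Rt.
rewrite funeqE => u; rewrite funeqE => v; rewrite propeqE; split.
  by case=> _ [w _ <-] [wu wv]; apply: Rt (Rs _ _ wu) wv.
by move=> uv; exists (R u); [exists u | split=> //; apply: Rr].
Qed.

Lemma CS_ext (X : Type) (a b : CS X) : same_block a = same_block b -> a = b.
Proof.
suff sub (c d : CS X) :
    same_block c = same_block d -> blocks c `<=` blocks d.
  move=> ab; have {ab}PQ : blocks a = blocks b.
    by rewrite eqEsubset; split; apply: sub.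
  case: a b PQ => [P hP] [Q hQ] /= PQ; case: _ / PQ hQ => hQ.
  by congr MkCS; apply: Prop_irrelevance.
move=> E U cU; have [u Uu] : U !=set0 by case: (blocksP c) => _ _; apply.
have [V dV Vu] := block_of d u; suff -> : U = V by [].
rewrite eqEsubset; split=> v => [Uv|Vv].
  have : same_block c u v by exists U.
  by rewrite E => -[W dW [Wu Wv]]; rewrite (block_inj dV dW Vu Wu).
have : same_block d u v by exists V.
by rewrite -E => -[W cW [Wu Wv]]; rewrite (block_inj cU cW Uu Wu).
Qed.

Section Connectivity.
Variables (T : Type) (step : T -> T -> Prop).

Inductive conn (u : T) : T -> Prop :=
| conn_refl : conn u u
| conn_step v w of conn u v & step v w : conn u w.

Lemma conn1 u v : step u v -> conn u v.
Proof. by apply: conn_step; apply: conn_refl. Qed.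

Lemma conn_trans u v w : conn u v -> conn v w -> conn u w.
Proof. by move=> uv; elim=> // ? ? _; apply: conn_step. Qed.

Lemma conn_sym (step_sym : forall u v, step u v -> step v u) u v :
  conn u v -> conn v u.
Proof.
elim=> [|v' w _ IH vw]; first exact: conn_refl.
exact: conn_trans (conn1 (step_sym _ _ vw)) IH.
Qed.

End Connectivity.

Lemma conn_map (T T' : Type) (step : T -> T -> Prop) (step' : T' -> T' -> Prop)
  (f : T -> T') : (forall u v, step u v -> conn step' (f u) (f v)) ->
  forall u v, conn step u v -> conn step' (f u) (f v).
Proof.
move=> h u v; elim=> [|v' w _ IH /h]; first exact: conn_refl.
exact: conn_trans.
Qed.

(* A node (i, x) is the copy of x at level i. The relation A joins levels 0
   and 1, B joins levels 1 and 2, and C joins levels 2 and 3. *)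
Section Levels.
Variable X : Type.
Implicit Types (A B C : X + X -> X + X -> Prop).

Definition lev (i : nat) (p : X + X) : nat * X :=
  match p with inl x => (i, x) | inr x => (i.+1, x) end.

Definition ends (p : X + X) : nat * X :=
  match p with inl x => (0, x) | inr x => (2, x) end.

Inductive step2 A B : nat * X -> nat * X -> Prop :=
| step2A p q of A p q : step2 A B (lev 0 p) (lev 0 q)
| step2B p q of B p q : step2 A B (lev 1 p) (lev 1 q).

Inductive step3 A B C : nat * X -> nat * X -> Prop :=
| step3A p q of A p q : step3 A B C (lev 0 p) (lev 0 q)
| step3B p q of B p q : step3 A B C (lev 1 p) (lev 1 q)
| step3C p q of C p q : step3 A B C (lev 2 p) (lev 2 q).

Definition flip (p : X + X) : X + X :=
  match p with inl x => inr x | inr x => inl x end.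

Definition swap A : X + X -> X + X -> Prop := fun p q => A (flip p) (flip q).

Definition flip2 (n : nat * X) : nat * X := (2 - n.1, n.2).
Definition flip3 (n : nat * X) : nat * X := (3 - n.1, n.2).

Lemma flipK p : flip (flip p) = p. Proof. by case: p. Qed.

Lemma swapK A : swap (swap A) = A.
Proof. by rewrite funeqE => u; rewrite funeqE => v; rewrite /swap !flipK. Qed.

Lemma swap_equiv A : is_equiv A -> is_equiv (swap A).
Proof.
by case=> r s t; split=> [u|u v|u v w]; [apply: r | apply: s | apply: t].
Qed.


Lemma step2_sym A B : is_equiv A -> is_equiv B ->
  forall u v, step2 A B u v -> step2 A B v u.
Proof.
by move=> eA eB _ _ [p q h|p q h]; [left; apply: equiv_sym|
  right; apply: equiv_sym].
Qed.

Lemma conn2_swap A B u v :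
  conn (step2 A B) u v -> conn (step2 (swap B) (swap A)) (flip2 u) (flip2 v).
Proof.
apply: conn_map => _ _ [p q h|p q h]; apply: conn1.
  have e r : flip2 (lev 0 r) = lev 1 (flip r) by case: r.
  by rewrite !e; right; rewrite /swap !flipK.
have e r : flip2 (lev 1 r) = lev 0 (flip r) by case: r.
by rewrite !e; left; rewrite /swap !flipK.
Qed.

Lemma conn3_swap A B C u v : conn (step3 A B C) u v ->
  conn (step3 (swap C) (swap B) (swap A)) (flip3 u) (flip3 v).
Proof.
apply: conn_map => _ _ [p q h|p q h|p q h]; apply: conn1.
- have e r : flip3 (lev 0 r) = lev 2 (flip r) by case: r.
  by rewrite !e; constructor 3; rewrite /swap !flipK.
- have e r : flip3 (lev 1 r) = lev 1 (flip r) by case: r.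
  by rewrite !e; constructor 2; rewrite /swap !flipK.
- have e r : flip3 (lev 2 r) = lev 0 (flip r) by case: r.
  by rewrite !e; constructor 1; rewrite /swap !flipK.
Qed.

Section Chains.
Variables (A B : X + X -> X + X -> Prop) (eA : is_equiv A) (eB : is_equiv B).
Let Atr := equiv_trans eA.
Let Btr := equiv_trans eB.

Lemma chain_conn x s c m :
  A (inl x) (inr (c 1)) ->
  (forall i, 1 <= i < s -> B (inl (c i.*2.-1)) (inl (c i.*2))) ->
  (forall i, 1 <= i < s -> A (inr (c i.*2)) (inr (c i.*2.+1))) ->
  1 <= m <= s -> conn (step2 A B) (0, x) (1, c m.*2.-1).
Proof.
move=> h1 hB hA; elim: m => // m IH /andP[_ ms].
case: m IH ms => [_ _|m IH ms].
  by apply: conn1; apply: (@step2A A B (inl x) (inr _)).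
have ms' : 1 <= m.+1 < s by [].
apply: conn_step (conn_step (IH (ltnW ms)) _) _.
  exact: (@step2B A B (inl _) (inl _) (hB _ ms')).
exact: (@step2A A B (inr _) (inr _) (hA _ ms')).
Qed.

Lemma glue_top_conn x y : glue_top A B x y -> conn (step2 A B) (0, x) (0, y).
Proof.
case=> [h|[s [c [s1 h1 hB hA h2]]]].
  by apply: conn1; apply: (@step2A A B (inl x) (inl y)).
have ss : 1 <= s <= s by rewrite s1 leqnn.
have hB' i : 1 <= i < s -> B (inl (c i.*2.-1)) (inl (c i.*2)).
  by case/andP=> i1 /ltnW is'; apply: hB; rewrite i1.
apply: conn_step (conn_step (chain_conn h1 hB' hA ss) _) _.
  exact: (@step2B A B (inl _) (inl _) (hB _ ss)).
exact: (@step2A A B (inr _) (inl _) h2).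
Qed.

Lemma glue_cross_conn x y :
  glue_cross A B x y -> conn (step2 A B) (0, x) (2, y).
Proof.
case=> [s [c [s1 h1 hB hA h2]]].
have ss : 1 <= s <= s by rewrite s1 leqnn.
apply: conn_step (chain_conn h1 hB hA ss) _.
exact: (@step2B A B (inl _) (inr _) h2).
Qed.

(* [alt x b m]: the element m of the middle level is reached from x on the top
   level by an alternating chain whose last link is in A if b, in B if not. *)
Inductive alt (x : X) : bool -> X -> Prop :=
| alt0 m of A (inl x) (inr m) : alt x true m
| altB m n of alt x true m & B (inl m) (inl n) : alt x false n
| altA m n of alt x false m & A (inr m) (inr n) : alt x true n.

Lemma altP x b m : alt x b m ->
  exists (s : nat) (c : nat -> X),
    [/\ 1 <= s,
        A (inl x) (inr (c 1)),
        forall i, 1 <= i < s + ~~ b -> B (inl (c i.*2.-1)) (inl (c i.*2)),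
        forall i, 1 <= i < s -> A (inr (c i.*2)) (inr (c i.*2.+1)) &
        c (s.*2 - b) = m].
Proof.
elim=> {b m} [m h|m n _ [s [c [s1 h1 hB hA cm]]] mn|
  m n _ [s [c [s1 h1 hB hA cm]]] mn].
- exists 1, (fun=> m); split=> // i; rewrite ?addn0.
    by rewrite ltnS; case: i.
  by rewrite ltnS; case: i.
- exists s, (fun k => if k < s.*2 then c k else n).
  have lt2 i : 0 < i < s -> (i.*2.-1 < s.*2) * (i.*2 < s.*2) * (i.*2.+1 < s.*2).
    by move=> hi; do !split; lia.
  split=> //.
  + by have -> : 1 < s.*2 by lia.
  + move=> i /andP[i1]; rewrite addn1 ltnS leq_eqVlt => /orP[/eqP->|iS].
      rewrite ltnn; have -> : s.*2.-1 < s.*2 by lia.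
      by move: cm; rewrite subn1 => ->.
    have hi : 0 < i < s by rewrite i1.
    by rewrite !lt2 //; apply: hB; rewrite addn0.
  + by move=> i hi; rewrite !lt2 //; apply: hA.
  + by rewrite subn0 ltnn.
- exists s.+1, (fun k => if k <= s.*2 then c k else n).
  have le2 i : 0 < i <= s -> (i.*2.-1 <= s.*2) * (i.*2 <= s.*2).
    by move=> hi; split; lia.
  split=> //.
  + by have -> : 1 <= s.*2 by lia.
  + move=> i hi; have hi' : 0 < i <= s by lia.
    by rewrite !le2 //; apply: hB; lia.
  + move=> i /andP[i1]; rewrite ltnS leq_eqVlt => /orP[/eqP->|iS].
      by rewrite leqnn ltnn; move: cm; rewrite subn0 => ->.
    have hi : 0 < i < s by rewrite i1.
    have -> : i.*2 <= s.*2 by lia.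
    have -> : i.*2 < s.*2 by lia.
    exact: hA.
  + by have -> : (s.+1.*2 - true <= s.*2) = false by lia.
Qed.

Lemma alt_top x m y :
  alt x false m -> A (inr m) (inl y) -> glue_top A B x y.
Proof.
move=> /altP[s [c [s1 h1 hB hA cm]]] my; right; exists s, c; split=> //.
  by move=> i hi; apply: hB; rewrite /= addn1 ltnS.
by move: cm; rewrite subn0 => ->.
Qed.

Lemma alt_cross x m y :
  alt x true m -> B (inl m) (inr y) -> glue_cross A B x y.
Proof.
move=> /altP[s [c [s1 h1 hB hA cm]]] my; exists s, c; split=> //.
  by move=> i hi; apply: hB; rewrite addn0.
by move: cm; rewrite subn1 => ->.
Qed.

Definition reach (x : X) (n : nat * X) : Prop :=
  match n with
  | (0, y) => A (inl x) (inl y) \/ exists2 m, alt x false m & A (inr m) (inl y)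
  | (1, m) => exists b, alt x b m
  | (_, y) => exists2 m, alt x true m & B (inl m) (inr y)
  end.

Lemma conn_reach x n : conn (step2 A B) (0, x) n -> reach x n.
Proof.
elim=> {n} [|n n' _ IH h]; first by left; apply: equiv_refl.
case: h IH => [[y|m] [z|k]|[m|y] [k|z]] h /=.
- by case=> [xy|[m am my]]; [left; apply: Atr h | right; exists m => //;
    apply: Atr h].
- case=> [xy|[m am my]]; exists true; first by apply: alt0; apply: Atr h.
  by apply: altA am _; apply: Atr h.
- case=> -[] a; last by right; exists m.
  move: h; inversion_clear a => h; first by left; apply: Atr h.
  by right; exists m0 => //; apply: Atr h.
- case=> -[] a; exists true; last exact: altA h.
  move: h; inversion_clear a => h; first by apply: alt0; apply: Atr h.
  by apply: (@altA _ m0) => //; apply: Atr h.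
- case=> -[] a; exists false; first exact: altB h.
  by move: h; inversion_clear a => h; apply: (@altB _ m0) => //; apply: Btr h.
- case=> -[] a; first by exists m.
  by move: h; inversion_clear a => h; exists m0 => //; apply: Btr h.
- by case=> m am my; exists false; apply: (altB am); apply: Btr h.
- by case=> m am my; exists m => //; apply: Btr h.
Qed.

Lemma glue_topP x y : glue_top A B x y <-> conn (step2 A B) (0, x) (0, y).
Proof.
split; first exact: glue_top_conn.
by move/conn_reach => [?|[m am my]]; [left | apply: alt_top am my].
Qed.

Lemma glue_crossP x y : glue_cross A B x y <-> conn (step2 A B) (0, x) (2, y).
Proof.
split; first exact: glue_cross_conn.
by move/conn_reach => [m am my]; apply: alt_cross am my.
Qed.

End Chains.

Lemma glueP A B u v : is_equiv A -> is_equiv B ->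
  glue A B u v <-> conn (step2 A B) (ends u) (ends v).
Proof.
move=> eA eB; case: u v => [x|x] [y|y] /=.
- exact: glue_topP.
- exact: glue_crossP.
- rewrite (glue_crossP eA eB).
  by split; apply: conn_sym; apply: step2_sym.
- rewrite -[glue_bot A B x y]/(glue_top (swap B) (swap A) x y).
  rewrite (glue_topP (swap_equiv eB) (swap_equiv eA)).
  split=> /conn2_swap; rewrite ?swapK; exact.
Qed.

Lemma glue_equiv A B : is_equiv A -> is_equiv B -> is_equiv (glue A B).
Proof.
move=> eA eB; split=> [u|u v|u v w]; rewrite !glueP //.
- exact: conn_refl.
- by apply: conn_sym; apply: step2_sym.
- exact: conn_trans.
Qed.

Lemma glue_swap A B : is_equiv A -> is_equiv B ->
  swap (glue A B) = glue (swap B) (swap A).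
Proof.
move=> eA eB; rewrite funeqE => u; rewrite funeqE => v; rewrite propeqE.
have [sA sB] := (swap_equiv eA, swap_equiv eB).
have e r : flip2 (ends r) = ends (flip r) by case: r.
rewrite /swap -/(swap _) !glueP //; split=> /conn2_swap;
  by rewrite !e ?flipK ?swapK.
Qed.

Definition ends3 (p : X + X) : nat * X :=
  match p with inl x => (0, x) | inr x => (3, x) end.

Section Glue3.
Variables (A B C : X + X -> X + X -> Prop).
Hypotheses (eA : is_equiv A) (eB : is_equiv B) (eC : is_equiv C).
Let AB := glue A B.
Let eAB : is_equiv AB := glue_equiv eA eB.

Definition squash (n : nat * X) : nat * X :=
  match n with (0, x) => (0, x) | (i.+1, x) => (i.+2, x) end.

Lemma glue_conn3 u v : glue AB C u v -> conn (step3 A B C) (ends3 u) (ends3 v).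
Proof.
rewrite glueP //.
have e r : ends3 r = squash (ends r) by case: r.
rewrite !e; apply: conn_map => _ _ [p q|p q h].
  have e1 r : squash (lev 0 r) = ends r by case: r.
  rewrite /AB glueP // !e1; apply: (conn_map (f := id)) => _ _ [r s h|r s h].
    by apply: conn1; constructor 1.
  by apply: conn1; constructor 2.
have e1 r : squash (lev 1 r) = lev 2 r by case: r.
by rewrite !e1; apply: conn1; constructor 3.
Qed.

Definition reach3 (u : X + X) (n : nat * X) : Prop :=
  let step := conn (step2 AB C) (ends u) in
  if n.1 is (_.+3) then step (2, n.2)
  else exists2 p, step (lev 0 p) & conn (step2 A B) (ends p) n.

Lemma conn_reach3 u n : conn (step3 A B C) (ends3 u) n -> reach3 u n.
Proof.
elim=> {n} [|n n' _ IH h].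
  case: u => x /=; last exact: conn_refl.
  by exists (inl x); apply: conn_refl.
case: h IH => [p q h|p q h|p q h] IH.
- have {IH}[r ur rp] : exists2 r, conn (step2 AB C) (ends u) (lev 0 r) &
    conn (step2 A B) (ends r) (lev 0 p) by case: p h IH.
  suff: exists2 r, conn (step2 AB C) (ends u) (lev 0 r) &
    conn (step2 A B) (ends r) (lev 0 q) by case: (q).
  by exists r => //; apply: conn_step rp (step2A _ h).
- have {IH}[r ur rp] : exists2 r, conn (step2 AB C) (ends u) (lev 0 r) &
    conn (step2 A B) (ends r) (lev 1 p) by case: p h IH.
  suff: exists2 r, conn (step2 AB C) (ends u) (lev 0 r) &
    conn (step2 A B) (ends r) (lev 1 q) by case: (q).
  by exists r => //; apply: conn_step rp (step2B _ h).
- have {IH} up : conn (step2 AB C) (ends u) (lev 1 p).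
    case: p h IH => // x _ [r ur]; rewrite -/(ends (inr x)) => rp.
    apply: conn_step ur _.
    by apply: (@step2A AB C r (inr x)); apply/glueP.
  have {up} uq := conn_step up (step2B _ h).
  case: q h uq => // x _ uq; exists (inr x) => //; exact: conn_refl.
Qed.

Lemma glue3P u v :
  glue (glue A B) C u v <-> conn (step3 A B C) (ends3 u) (ends3 v).
Proof.
split; first exact: glue_conn3.
move/conn_reach3; case: v => y /=; last by rewrite glueP.
case=> r ur ry; rewrite glueP //; apply: conn_step ur _.
by apply: (@step2A AB C r (inl y)); apply/glueP.
Qed.

End Glue3.

Lemma glueA A B C : is_equiv A -> is_equiv B -> is_equiv C ->
  glue A (glue B C) = glue (glue A B) C.
Proof.
move=> eA eB eC.
have [[sA sB] sC] := (swap_equiv eA, swap_equiv eB, swap_equiv eC).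
have eBC := glue_equiv eB eC.
have E : swap (glue A (glue B C)) = glue (glue (swap C) (swap B)) (swap A).
  by rewrite !glue_swap.
rewrite -[LHS]swapK E.
rewrite funeqE => u; rewrite funeqE => v; rewrite propeqE /swap -/(swap _).
rewrite !glue3P //.
have e r : flip3 (ends3 r) = ends3 (flip r) by case: r.
split=> /conn3_swap; by rewrite !e ?flipK ?swapK.
Qed.

End Levels.

Section Product.
Variable X : Type.
Implicit Types a b c : CS X.

Definition mul_CS a b : CS X :=
  CS_of (glue_equiv (same_block_equiv a) (same_block_equiv b)).

Lemma same_block_mul a b :
  same_block (mul_CS a b) = glue (same_block a) (same_block b).
Proof. exact: same_block_CS_of. Qed.

Lemma mul_CSA : associative mul_CS.
Proof.
move=> a b c; apply: CS_ext; rewrite !same_block_mul.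
by apply: glueA; apply: same_block_equiv.
Qed.

End Product.

HB.instance Definition _ (X : Type) := isSemigroup.Build (CS X) (@mul_CSA X).

Definition IP (X : Type) : set (CS X) :=
  [set a | forall U, blocks a U ->
     (exists x, U (inl x)) /\ (exists x, U (inr x))].

Lemma UpsilonP (X : Type) (X2 : exists x y : X, x <> y) :
  partition [set range (@inl X X); range (@inr X X)] id [set: X + X].
Proof.
have [x0 _] := X2; split.
- rewrite eqEsubset; split=> // -[x|x] _.
    by exists (range inl); [left | exists x].
  by exists (range inr); [right | exists x].
- by move=> _ _ [->|->] [->|->] [z [[x _ <-] [y _]]].
- by move=> _ [->|->]; [exists (inl x0), x0 | exists (inr x0), x0].
Qed.

(* The two blocks X and X' are nonempty because X has two distinct elements. *)
Definition Upsilon (X : Type) (X2 : exists x y : X, x <> y) : CS X :=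
  MkCS (UpsilonP X2).

(* Main.v *)
Require Import Defs.
From mathcomp Require Import all_boot.
From mathcomp Require Import boolp classical_sets.
Local Open Scope classical_set_scope.

(** The partition Upsilon satisfies Upsilon b Upsilon = Upsilon for every b, and
    it is a zero for IP_X. In IP_X the idempotents are the partitions with
    x equivalent to x' for all x; they commute, so inverses are unique, and the
    mirror image of a is an inverse of a. For maximality, let b lie in an inverse
    semigroup containing Upsilon. Both b Upsilon and Upsilon are inverses of
    b Upsilon, hence b Upsilon = Upsilon, and dually Upsilon b = Upsilon. The
    former says that b has no block inside X other than X itself, the latter
    that b has no block inside X' other than X' itself. *)

Section PartitionSemigroup.
Local Set Implicit Arguments.
Local Unset Strict Implicit.
Local Open Scope group_scope.
Context {X : Type}.
Implicit Types (a b e f : CS X) (u v w : X + X) (x y : X).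

(** * Block relations, products and mirror images *)

Lemma same_block_refl a u : same_block a u u.
Proof. by case: (same_block_equiv a) => r _ _; apply: r. Qed.

Lemma same_block_sym a u v : same_block a u v -> same_block a v u.
Proof. by case: (same_block_equiv a) => _ s _; apply: s. Qed.

Lemma same_block_trans a u v w :
  same_block a u v -> same_block a v w -> same_block a u w.
Proof. by case: (same_block_equiv a) => _ _ t; apply: t. Qed.

Lemma CS_extP a b :
  (forall u v, same_block a u v <-> same_block b u v) -> a = b.
Proof.
move=> h; apply: CS_ext; rewrite funeqE => u; rewrite funeqE => v.
by rewrite propeqE.
Qed.

Lemma same_block_mulg a b :
  same_block (a * b) = glue (same_block a) (same_block b).
Proof. exact: same_block_mul. Qed.

Lemma same_block_mulP a b u v : same_block (a * b) u v <->
  conn (step2 (same_block a) (same_block b)) (ends u) (ends v).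
Proof. by rewrite same_block_mulg; apply: glueP; apply: same_block_equiv. Qed.

(** Mirror image under the exchange of X and X'. It is an involution that reverses products, so
    facts about X carry over to X'. *)
Definition star a : CS X := CS_of (swap_equiv (same_block_equiv a)).

Lemma same_block_star a : same_block (star a) = swap (same_block a).
Proof. exact: same_block_CS_of. Qed.

Lemma starK a : star (star a) = a.
Proof. by apply: CS_ext; rewrite !same_block_star swapK. Qed.

Lemma starM a b : star (a * b) = star b * star a.
Proof.
apply: CS_ext; rewrite same_block_star !same_block_mulg !same_block_star.
by apply: glue_swap; apply: same_block_equiv.
Qed.

(** Folds the layers of [a], [star a], [a] onto one copy of X and X'; the middle layer is reversed,
    so every step becomes a relation of [a]. *)
Definition fold3 (n : nat * X) : X + X :=
  match n with (0, x) | (2, x) => inl x | (_, x) => inr x end.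

Lemma mul_star_mul a : a * star a * a = a.
Proof.
apply: CS_extP => u v; rewrite !same_block_mulg same_block_star glue3P;
  try exact: same_block_equiv; last first.
  exact: swap_equiv (same_block_equiv a).
set S := step3 _ _ _.
have S_sym n m : S n m -> S m n.
  by case=> p q h; [constructor 1|constructor 2|constructor 3];
    apply: same_block_sym.
split.
  have foldK w : w = fold3 (ends3 w) by case: w.
  rewrite {2}[u]foldK {2}[v]foldK; elim=> [|n m _ IH nm]; first exact: same_block_refl.
  apply: same_block_trans IH _.
  by case: nm => -[x|x] [y|y].
(* The link from x to y' is traversed forwards, backwards and forwards again: (0,x), (1,y), (2,x),
   (3,y). *)
have cross x y : same_block a (inl x) (inr y) -> conn S (0, x) (3, y).
  move=> xy; apply: (@conn_step _ _ _ (2, x)); last first.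
    by apply: (@step3C _ _ _ _ (inl x) (inr y)).
  apply: (@conn_step _ _ _ (1%N, y)); last first.
    by apply: (@step3B _ _ _ _ (inl y) (inr x)); apply: same_block_sym.
  by apply: conn1; apply: (@step3A _ _ _ _ (inl x) (inr y)).
case: u v => [x|x] [y|y] h /=.
- by apply: conn1; apply: (@step3A _ _ _ _ (inl x) (inl y)).
- exact: cross.
- by apply: (conn_sym S_sym); apply: cross; apply: same_block_sym.
- by apply: conn1; apply: (@step3C _ _ _ _ (inr x) (inr y)).
Qed.

Lemma inverse_of_star a : inverse_of a (star a).
Proof.
by split; rewrite ?mul_star_mul // -{2}[a]starK mul_star_mul.
Qed.

(** * The semigroup IP_X *)

Lemma IP_crossP a : IP a <->
  (forall x, exists y, same_block a (inl x) (inr y)) /\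
  (forall y, exists x, same_block a (inl x) (inr y)).
Proof.
split=> [aIP|[top bot] U aU].
  split=> z.
    by have [U aU Uz] := block_of a (inl z); have [_ [y Uy]] := aIP U aU;
      exists y, U.
  by have [U aU Uz] := block_of a (inr z); have [[x Ux] _] := aIP U aU;
    exists x, U.
have sat u v : U u -> same_block a u v -> U v.
  by move=> Uu [V aV [Vu Vv]]; rewrite (block_inj aU aV Uu Vu).
have [_ _ /(_ _ aU) [[z|z] Uz]] := blocksP a.
  by have [y zy] := top z; split; [exists z | exists y; apply: sat zy].
have [x xz] := bot z; split; [exists x | by exists z].
by apply: sat (same_block_sym xz).
Qed.

Lemma IP_star a : IP a -> IP (star a).
Proof.
move=> /IP_crossP[top bot]; apply/IP_crossP; rewrite same_block_star.
by split=> z; [have [x h] := bot z; exists x | have [x h] := top z; exists x];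
  apply: same_block_sym.
Qed.

Lemma mul_cross a b x y z : same_block a (inl x) (inr y) ->
  same_block b (inl y) (inr z) -> same_block (a * b) (inl x) (inr z).
Proof.
move=> xy yz; apply/same_block_mulP.
apply: (@conn_step _ _ _ (1%N, y)); last first.
  by apply: (@step2B _ _ _ (inl y) (inr z)).
by apply: conn1; apply: (@step2A _ _ _ (inl x) (inr y)).
Qed.

Lemma IP_mul a b : IP a -> IP b -> IP (a * b).
Proof.
move=> /IP_crossP[ta ba] /IP_crossP[tb bb]; apply/IP_crossP; split=> z.
  by have [y zy] := ta z; have [t yt] := tb y; exists t; apply: mul_cross zy yt.
by have [y yz] := bb z; have [t ty] := ba y; exists t; apply: mul_cross ty yz.
Qed.

(** * Idempotents and inverses in IP_X *)

(** Choose y and z with y related to x' and x to z'. Idempotency relates y to z', which links x, z',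
    y, x' in turn. *)
Lemma IP_idem_diag e x : IP e -> e * e = e -> same_block e (inl x) (inr x).
Proof.
move=> /IP_crossP[top bot] ee; have [y yx] := bot x; have [z xz] := top x.
have := mul_cross yx xz; rewrite ee => yz.
exact: same_block_trans xz (same_block_trans (same_block_sym yz) yx).
Qed.

Lemma IP_idem_mul_sub e f u v :
  IP e -> IP f -> e * e = e -> f * f = f ->
  same_block (e * f) u v -> same_block (f * e) u v.
Proof.
move=> eIP fIP ee ff /same_block_mulP uv; apply/same_block_mulP.
(* All nodes of a path for [e * f] are projected to the middle level of [f * e]. Since both
   diagonals are present, [e]-steps become steps of the lower layer and [f]-steps steps of the upper
   one. *)
pose mid (n : nat * X) := (1%N, n.2).
have step_sym := step2_sym (same_block_equiv f) (same_block_equiv e).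
have to_mid w : conn (step2 (same_block f) (same_block e)) (ends w)
    (mid (ends w)).
  case: w => z; apply: conn1.
    by apply: (@step2A _ _ _ (inl z) (inr z)); apply: IP_idem_diag.
  apply: step_sym.
  by apply: (@step2B _ _ _ (inl z) (inr z)); apply: IP_idem_diag.
apply: conn_trans (to_mid u) _.
apply: conn_trans (conn_sym step_sym (to_mid v)).
apply: conn_map uv => _ _ [p q|p q] pq; apply: conn1.
  have r0 r : mid (lev 0 r) = lev 1 (inl (lev 0 r).2) by [].
  rewrite !r0; apply: step2B.
  have h r : same_block e r (inl (lev 0 r).2).
    case: r => z; first exact: same_block_refl.
    by apply: same_block_sym; apply: IP_idem_diag.
  exact: same_block_trans (same_block_sym (h p))
    (same_block_trans pq (h q)).
have r1 r : mid (lev 1 r) = lev 0 (inr (lev 1 r).2) by [].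
rewrite !r1; apply: step2A.
have h r : same_block f r (inr (lev 1 r).2).
  case: r => z; last exact: same_block_refl.
  exact: IP_idem_diag.
exact: same_block_trans (same_block_sym (h p))
  (same_block_trans pq (h q)).
Qed.

Lemma IP_idem_comm e f :
  IP e -> IP f -> e * e = e -> f * f = f -> e * f = f * e.
Proof.
by move=> eIP fIP ee ff; apply: CS_extP => u v; split; apply: IP_idem_mul_sub.
Qed.

(** Commuting idempotents give (ab)(ac) = ab and (ba)(ca) = ca, whence b = bac = c. *)
Lemma IP_inverse_uniq a b c : IP a -> IP b -> IP c ->
  inverse_of a b -> inverse_of a c -> b = c.
Proof.
move=> aIP bIP cIP [aba bab] [aca cac].
have abI : (a * b) * (a * b) = a * b by rewrite mulgA aba.
have acI : (a * c) * (a * c) = a * c by rewrite mulgA aca.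
have baI : (b * a) * (b * a) = b * a by rewrite mulgA bab.
have caI : (c * a) * (c * a) = c * a by rewrite mulgA cac.
have abc : (a * b) * (a * c) = a * b.
  rewrite IP_idem_comm //; try exact: IP_mul.
  by rewrite mulgA aca.
have bca : (b * a) * (c * a) = c * a.
  rewrite IP_idem_comm //; try exact: IP_mul.
  by rewrite -mulgA [a * _]mulgA aba.
have -> : b = b * a * c by rewrite -{1}bab -mulgA -abc !mulgA bab.
by rewrite -{2}cac -bca -!mulgA [c * (a * c)]mulgA cac.
Qed.

(** * Products with Upsilon *)

Section Zero.
Hypothesis X2 : exists x y : X, x <> y.
Let U := Upsilon X2.

Lemma same_block_Upsilon u v : same_block U u v <-> is_inl u = is_inl v.
Proof.
split=> [[V [->|->] [[x _ <-] [y _ <-]]]|] //.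
by case: u v => [x|x] [y|y] // _; [exists (range inl) | exists (range inr)];
  [left | split; [exists x | exists y] | right | split; [exists x | exists y]].
Qed.

Lemma Upsilon_notIP : ~ IP U.
Proof.
have [x _] := X2.
by move=> /IP_crossP[/(_ x)[y /same_block_Upsilon]].
Qed.

Lemma star_Upsilon : star U = U.
Proof.
apply: CS_extP => u v; rewrite same_block_star /swap !same_block_Upsilon.
by case: u v => [x|x] [y|y].
Qed.

(** X' is a block of the right factor, and a chain from X to X' would need a last link of [U] from X
    to X'. Only the relation on X remains to be checked. *)
Lemma mul_Upsilon a :
  (forall x y, same_block (a * U) (inl x) (inl y)) -> a * U = U.
Proof.
have nocross x y : ~ same_block (a * U) (inl x) (inr y).
  by rewrite same_block_mulg => -[s [c [_ _ _ _ /same_block_Upsilon]]].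
move=> top; apply: CS_extP => u v; rewrite same_block_Upsilon.
case: u v => [x|x] [y|y]; split=> //=.
- by move=> /nocross.
- by move=> /same_block_sym/nocross.
- by move=> _; rewrite same_block_mulg; left; apply/same_block_Upsilon.
Qed.

Lemma Upsilon_sandwich b : U * b * U = U.
Proof.
apply: mul_Upsilon => x y; rewrite same_block_mulg; left.
by rewrite same_block_mulg; left; apply/same_block_Upsilon.
Qed.

Lemma Upsilon_idem : U * U = U.
(* UU = U(UUU) = U(UU)U = U, by the sandwich identity twice. *)
Proof. by rewrite -{2}(Upsilon_sandwich U) mulgA Upsilon_sandwich. Qed.

Lemma IP_mul_Upsilon a : IP a -> a * U = U.
Proof.
move=> /IP_crossP[top _]; apply: mul_Upsilon => x y; rewrite same_block_mulg.
have [z xz] := top x; have [t yt] := top y.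
(* One round trip suffices: x to z', then z to t inside the block X of [U], then t' to y. *)
right; exists 1%N, (fun i => if i == 1%N then z else t); split=> //.
- by move=> i _; apply/same_block_Upsilon.
- by case.
- exact: same_block_sym.
Qed.

Lemma IP_Upsilon_mul a : IP a -> U * a = U.
Proof.
move=> /IP_star/IP_mul_Upsilon h.
by rewrite -[LHS]starK starM star_Upsilon h star_Upsilon.
Qed.

(** * Partitions for which Upsilon is a zero *)

(** A chain leaving x would start with a link of [b] into X', so the relation in [b * U] must come
    from [b] itself. *)
Lemma mul_Upsilon_top_block b x : b * U = U ->
  (forall y, ~ same_block b (inl x) (inr y)) ->
  forall y, same_block b (inl x) (inl y).
Proof.
move=> bU nx y; have : same_block (b * U) (inl x) (inl y).
  by rewrite bU; apply/same_block_Upsilon.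
by rewrite same_block_mulg => -[|[s [c [_ /nx]]]].
Qed.

Lemma zero_IP_or_Upsilon_top b x : b * U = U -> U * b = U ->
  (forall y, ~ same_block b (inl x) (inr y)) -> b = U.
Proof.
move=> bU Ub nx; have top := mul_Upsilon_top_block bU nx.
have nocross y z : ~ same_block b (inl y) (inr z).
  by move=> yz; apply: (nx z); apply: same_block_trans (top y) yz.
have sbU : star b * U = U by rewrite -star_Upsilon -starM Ub.
have bot y z : same_block b (inr y) (inr z).
  have := mul_Upsilon_top_block sbU; rewrite same_block_star; apply.
  by move=> t /same_block_sym; apply: nocross.
apply: CS_extP => u v; rewrite same_block_Upsilon.
case: u v => [y|y] [z|z]; split=> //=.
- by move=> _; apply: same_block_trans (same_block_sym (top y)) (top z).
- by move=> /nocross.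
- by move=> /same_block_sym/nocross.
Qed.

Lemma zero_IP_or_Upsilon b : b * U = U -> U * b = U -> IP b \/ b = U.
Proof.
move=> bU Ub; have [|bIP] := pselect (b = U); first by right.
left; apply/IP_crossP; split=> x; apply: contrapT => nx; apply: bIP.
  by apply: (@zero_IP_or_Upsilon_top _ x) => // y xy; apply: nx; exists y.
(* A point of X' unrelated to X is handled by the mirror image. *)
rewrite -[b]starK -star_Upsilon; congr star.
apply: (@zero_IP_or_Upsilon_top _ x).
- by rewrite -star_Upsilon -starM Ub.
- by rewrite -star_Upsilon -starM bU.
by move=> y; rewrite same_block_star => /same_block_sym xy; apply: nx; exists y.
Qed.

(** * Inverse subsemigroups containing Upsilon *)

Lemma inverse_subsemigroup_zero (B : set (CS X)) b :
  inverse_subsemigroup B -> B U -> B b -> b * U = U /\ U * b = U.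
Proof.
move=> [[_ Bmul] Binv] BU Bb.
have bUbU : b * U * b * U = b * U by rewrite -!mulgA [U * _]mulgA Upsilon_sandwich.
have UbUb : U * b * U * b = U * b by rewrite Upsilon_sandwich.
(* An idempotent is its own inverse, so it equals any other inverse of it in [B]. *)
have uniq c d : B c -> B d -> inverse_of c d -> c * c = c -> c = d.
  move=> Bc Bd cd cc; have [y [_ yU]] := Binv c Bc.
  have <- : y = d by apply: yU.
  by apply: esym; apply: yU; split=> //; split; rewrite !cc.
split; apply: uniq => //; try exact: Bmul.
- by split; [rewrite -[b * U * U]mulgA Upsilon_idem mulgA
    | rewrite mulgA Upsilon_sandwich Upsilon_idem].
- by rewrite mulgA.
- by split; [rewrite Upsilon_sandwich mulgA Upsilon_idem
    | rewrite mulgA Upsilon_idem Upsilon_sandwich].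
- by rewrite mulgA.
Qed.

Lemma inverse_subsemigroup_IP_Upsilon :
  inverse_subsemigroup (@IP X `|` [set U]).
Proof.
split; first split; first by exists U; right.
  move=> a b [aIP|->] [bIP|->]; [left|right|right|right].
  - exact: IP_mul.
  - exact: IP_mul_Upsilon.
  - exact: IP_Upsilon_mul.
  - exact: Upsilon_idem.
move=> a [aIP|->].
  exists (star a); split.
    by split; [left; apply: IP_star | apply: inverse_of_star].
  move=> b [[bIP|->] ab].
    exact: IP_inverse_uniq (IP_star aIP) bIP (inverse_of_star a) ab.
  (* If [U] were an inverse of a in IP_X, then a = aUa = U would put [U] in IP_X. *)
  case: ab; rewrite IP_mul_Upsilon // IP_Upsilon_mul // => aU.
  by case: Upsilon_notIP; rewrite aU.
exists U; split; first by split; [right | split; rewrite !Upsilon_idem].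
(* An inverse b in IP_X would satisfy b = bUb = U. *)
move=> b [[bIP|-> //] [_]].
by rewrite IP_mul_Upsilon // IP_Upsilon_mul.
Qed.

End Zero.
End PartitionSemigroup.

Theorem proposition11 (X : Type) (X2 : exists x y : X, x <> y) :
  maximal_inverse_subsemigroup (@IP X `|` [set Upsilon X2]).
Proof.
split; first exact: inverse_subsemigroup_IP_Upsilon.
move=> B Binv sub; rewrite eqEsubset; split=> // b Bb.
have [bU Ub] : (b * Upsilon X2 = Upsilon X2)%g /\ (Upsilon X2 * b = Upsilon X2)%g.
  by apply: inverse_subsemigroup_zero Binv _ Bb; apply: sub; right.
by have [] := zero_IP_or_Upsilon bU Ub; [left | right].
Qed.
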